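(* (i) For every $L>0$, the map $\Delta\mapsto\mathrm P_\Delta(|\hat\tau_{\rm ST}-\tau|\le L(1+\gamma)^{-1/2}\sigma_0)$ is symmetric about $\Delta=0$ and monotonically decreasing in $|\Delta|$. (ii) For every $t\in\mathbb R$ and $L\ge0$, with $c=c_{\alpha/2}$, \begin{align*} G_{\rm ST}(t,L):={}&\mathrm P_{\Delta/\sigma_0=t}\big(|\hat\tau_{\rm ST}-\tau|\le L(1+\gamma)^{-1/2}\sigma_0\big)\\ ={}&\Big[\Phi\big(c-\sqrt{\tfrac{\gamma}{1+\gamma}}t\big)-\Phi\big(-c-\sqrt{\tfrac{\gamma}{1+\gamma}}t\big)\Big]\Big[\Phi\big(L-\tfrac{\gamma}{\sqrt{1+\gamma}}t\big)-\Phi\big(-L-\tfrac{\gamma}{\sqrt{1+\gamma}}t\big)\Big]\\ &+\int_{-\infty}^{-c-\sqrt{\frac{\gamma}{1+\gamma}}t}\big[\Phi(L+\sqrt\gamma(u+c))-\Phi(-L+\sqrt\gamma(u+c))\big]\phi(u)\,du\\ &+\int_{c-\sqrt{\frac{\gamma}{1+\gamma}}t}^{\infty}\big[\Phi(L+\sqrt\gamma(u-c))-\Phi(-L+\sqrt\gamma(u-c))\big]\phi(u)\,du. \end{align*} (iii) Fix $b\ge0$ and $\zeta\in(0,1)$, and let \[ \hat L_{\rm ST}=\inf\Big\{L\ge0:\inf_{\Delta:|\Delta/\sigma_0|\le b}\mathrm P_\Delta\big(|\hat\tau_{\rm ST}-\tau|\le L(1+\gamma)^{-1/2}\sigma_0\big)\ge1-\zeta\Big\}.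 \] Then $\hat L_{\rm ST}$ is the solution in $L$ of $G_{\rm ST}(b,L)=1-\zeta$. Hence $[\hat\tau_{\rm ST}\pm\hat L_{\rm ST}(1+\gamma)^{-1/2}\sigma_0]$ is the shortest symmetric interval centered at $\hat\tau_{\rm ST}$, with data-independent half-length, having coverage at least $1-\zeta$ uniformly over $|\Delta/\sigma_0|\le b$.
   Context: Let $\tau\in\mathbb R$ be an unknown parameter and $\Delta\in\mathbb R$ an unknown bias. Let $\sigma_0,\sigma_1>0$ be known. We observe independent random variables $\hat\tau_0\sim N(\tau,\sigma_0^2)$ and $\hat\tau_1\sim N(\tau+\Delta,\sigma_1^2)$. Define $\gamma=\sigma_0^2/\sigma_1^2$ and $\sigma=\sqrt{\sigma_0^2+\sigma_1^2}$. Write $\Phi$ and $\phi$ for the standard normal CDF and density. For $a\in(0,1)$, let $c_a=\Phi^{-1}(1-a)$. Fix a tuning level $\alpha\in(0,1)$. Let $\mathcal A=\{|\hat\tau_1-\hat\tau_0|\le\sigma c_{\alpha/2}\}$. The soft-thresholding estimator is \[ \hat\tau_{\rm ST}=\hat\tau_0+\frac{\gamma}{1+\gamma}(\hat\tau_1-\hat\tau_0)\mathbf 1(\mathcal A)+\frac{\gamma}{1+\gamma}\sigma c_{\alpha/2}\,\mathrm{sign}(\hat\tau_1-\hat\tau_0)\mathbf 1(\mathcal A^c). \] $\mathrm P_\Delta$ denotes probability under bias $\Delta$, and $\mathrm P_{\Delta/\sigma_0=t}$ means probability under $\Delta=t\sigma_0$. These probabilities do not depend on $\tau$. *)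

(* Defs.v *)
From HB Require Import structures.
From mathcomp Require Import all_boot all_order all_algebra.
From mathcomp Require Import all_classical all_reals all_analysis.
Set Implicit Arguments.
Unset Strict Implicit.
Unset Printing Implicit Defensive.
Import Order.TTheory GRing.Theory Num.Theory.
Import numFieldNormedType.Exports.
Local Open Scope classical_set_scope.
Local Open Scope ring_scope.

Definition phi {R : realType} (x : R) : R := normal_pdf 0 1 x.
Definition Phi {R : realType} (x : R) : R := fine (normal_prob 0 1 `]-oo, x]).

(* c_a = Phi^{-1}(1 - a), as the (generalized) quantile function *)
Definition crit {R : realType} (a : R) : R := inf [set x : R | 1 - a <= Phi x].

Definition gam {R : realType} (s0 s1 : R) : R := s0 ^+ 2 / s1 ^+ 2.
Definition sig {R : realType} (s0 s1 : R) : R := Num.sqrt (s0 ^+ 2 + s1 ^+ 2).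

Definition tauST {R : realType} (s0 s1 alpha : R) (x0 x1 : R) : R :=
  let g := gam s0 s1 in
  let thr := sig s0 s1 * crit (alpha / 2) in
  if `|x1 - x0| <= thr then x0 + g / (1 + g) * (x1 - x0)
  else x0 + g / (1 + g) * thr * Num.sg (x1 - x0).

(* P_Delta(|tauST - tau| <= L (1+gamma)^(-1/2) s0), with
   hat tau_0 ~ N(tau, s0^2) independent of hat tau_1 ~ N(tau + Delta, s1^2) *)
Definition covST {R : realType} (s0 s1 alpha tau Delta L : R) : R :=
  fine ((normal_prob tau s0 \x normal_prob (tau + Delta) s1)%E
    [set z : R * R | `|tauST s0 s1 alpha z.1 z.2 - tau|
                       <= L * (Num.sqrt (1 + gam s0 s1))^-1 * s0]).

(* Main.v *)
Require Import Defs.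
From HB Require Import structures.
From mathcomp Require Import all_boot all_order all_algebra.
From mathcomp Require Import all_classical all_reals all_analysis.
From mathcomp Require Import measurable_realfun ring lra.
Import Order.TTheory GRing.Theory Num.Theory.
Import numFieldNormedType.Exports.
Local Open Scope classical_set_scope.
Local Open Scope ring_scope.

(* Write [m = Delta / sigma]. The standardized difference [w + m] of the two
   observations and the standardized precision-weighted mean [v] are independent
   Gaussians, and the soft-thresholding estimator satisfies
     tauST - tau = s0 / sqrt (1 + gamma) * (v + sqrt gamma * h),
   where [h = clip (w + m) - w], the clipping being to [[- c, c]]. Integrating
   [v] out leaves the expectation in [w] of [window L (sqrt gamma * h)], with
   [window L x = Phi (L - x) - Phi (- L - x)]; cutting the line at [- c - m] and
   [c - m] gives (ii). The window is even and decreasing in [|x|], and [h] is the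
   projection of [m] onto [[- c - w, c - w]], so [|h|] is nondecreasing in
   [m >= 0] for every [w]; as changing the signs of [m] and [w] changes that of
   [h], this is (i). In [L] the coverage is Lipschitz and
   strictly increasing from 0 to 1, which with (i) gives (iii). *)

(** * Affine changes of variable for Lebesgue integrals *)

Section affine_substitution.
Context {R : realType}.
Local Notation mu := (@lebesgue_measure R).
Local Open Scope ereal_scope.
Implicit Types (a b : R) (f : R -> \bar R).

Definition affine a b : measurableTypeR R -> measurableTypeR R :=
  fun x => (a * x + b)%R.

Lemma measurable_affine a b : measurable_fun setT (affine a b).
Proof. by apply: measurable_funD => //; exact: measurable_funM. Qed.

(** Lebesgue measure is determined by its values on half-open intervals, and there the rescaled
    pushforward [nu] also gives the length. *)
Lemma lebesgue_measure_affine a b (A : set R) : (0 < a)%R -> measurable A ->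
  mu A = a%:E * mu (affine a b @^-1` A).
Proof.
move=> a0 mA; have mf := measurable_affine a b.
pose nu := mscale (NngNum (ltW a0)) (pushforward mu (affine a b)).
transitivity (nu mf A) => //.
apply: lebesgue_measure_unique => // _ [[x y]] /= _ <-.
rewrite /nu /mscale/= /pushforward/=.
rewrite [X in _ * mu X](_ : _ = `](x - b) / a, (y - b) / a]%classic)%R.
  rewrite !lebesgue_measure_itv/= !lte_fin ltr_pM2r ?invr_gt0// ltrD2r.
  case: ifPn => // _; last by rewrite mule0.
  by rewrite -!EFinB -EFinM; congr EFin; field; rewrite gt_eqF.
apply/seteqP; split => z/=; rewrite !in_itv/= ltr_pdivrMr// ler_pdivlMr// /affine;
  move=> /andP[? ?]; apply/andP; split; lra.
Qed.

Lemma ge0_integral_affine a b f : (0 < a)%R ->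
  measurable_fun setT f -> (forall x, 0 <= f x) ->
  \int[mu]_x f x = a%:E * \int[mu]_x f (a * x + b)%R.
Proof.
move=> a0 mf f0; have mab := measurable_affine a b.
pose nu := mscale (NngNum (ltW a0)) (pushforward mu (affine a b)).
transitivity (\int[nu mab]_x f x).
  by apply: eq_measure_integral => // A mA _; exact: lebesgue_measure_affine.
by rewrite ge0_integral_mscale//= ge0_integral_pushforward.
Qed.

Lemma ge0_integralN f : measurable_fun setT f -> (forall x, 0 <= f x) ->
  \int[mu]_x f x = \int[mu]_x f (- x)%R.
Proof.
move=> mf f0.
have mN : measurable_fun setT (-%R : measurableTypeR R -> measurableTypeR R).
  exact: oppr_measurable.
rewrite -(@ge0_integral_pushforward _ _ _ _ R _ mN mu setT f)//.
by apply: eq_measure_integral => A mA _; exact/esym/lebesgue_measureN.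
Qed.

End affine_substitution.

(** * Gaussian integrals as Lebesgue integrals *)

Section normal_density.
Context {R : realType}.
Local Notation mu := (@lebesgue_measure R).
Local Open Scope ereal_scope.

(** The Radon-Nikodym derivative of the Gaussian law and [normal_pdf] have the same integral over
    every measurable set, hence agree almost everywhere. *)
Lemma ge0_integral_normal_prob (m s : R) (f : R -> \bar R) :
  measurable_fun setT f -> (forall x, 0 <= f x) ->
  \int[normal_prob m s]_x f x = \int[mu]_x (f x * (normal_pdf m s x)%:E).
Proof.
move=> mf f0; have numu := normal_prob_dominates m s.
rewrite -(Radon_Nikodym_SigmaFinite.change_of_variables numu)//.
have fi := Radon_Nikodym_SigmaFinite.f_integrable numu.
have mp : measurable_fun setT (fun x : measurableTypeR R => (normal_pdf m s x)%:E).
  by apply/measurable_EFinP; exact: measurable_normal_pdf.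
apply: ae_eq_integral => //.
- by apply: emeasurable_funM => //; exact: measurable_int fi.
- exact: emeasurable_funM.
apply: ae_eqe_mul2l; apply: integral_ae_eq => //.
by move=> E _ mE; rewrite -Radon_Nikodym_SigmaFinite.f_integral.
Qed.

End normal_density.

(** * Rotation of two independent Gaussians *)

Section normal_pair.
Context {R : realType}.
Local Notation mu := (@lebesgue_measure R).
Implicit Types m s sigma : R.

(** The standardized arguments of the two densities are [(s1 * v - s0 * w) / sigma] and
    [(s1 * w + s0 * v) / sigma], a rotation of [(v, w)], so the sum of squares is preserved. The
    Jacobian [s0 * s1] cancels the scales in the two peaks. *)
Lemma normal_pdf_rotation m0 m1 s0 s1 sigma (w v : R) :
  0 < s0 -> 0 < s1 -> 0 < sigma -> sigma ^+ 2 = s0 ^+ 2 + s1 ^+ 2 ->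
  s0 * s1 * (normal_pdf m0 s0 (s0 * s1 / sigma * v + (m0 - s0 ^+ 2 / sigma * w))
    * normal_pdf m1 s1 (sigma * w
        + (s0 * s1 / sigma * v + (m0 - s0 ^+ 2 / sigma * w) + (m1 - m0))))
  = normal_pdf 0 1 w * normal_pdf 0 1 v.
Proof.
move=> s00 s10 sg0 sgE.
rewrite !normal_pdfE ?gt_eqF// /normal_peak /normal_fun.
have peakE (s : R) : 0 < s ->
    (Num.sqrt (s ^+ 2 * pi *+ 2))^-1 = s^-1 * (Num.sqrt (1 ^+ 2 * pi *+ 2))^-1.
  move=> s0'; rewrite expr1n mul1r -mulrnAr sqrtrM ?sqr_ge0// sqrtr_sqr gtr0_norm//.
  by rewrite invfM.
rewrite (peakE _ s00) (peakE _ s10); set p := (Num.sqrt _)^-1.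
set E0 := expR _; set E1 := expR _; set E2 := expR _; set E3 := expR _.
have -> : s0 * s1 * (s0^-1 * p * E0 * (s1^-1 * p * E1)) = p ^+ 2 * (E0 * E1).
  by field; rewrite !gt_eqF.
have -> : p * E2 * (p * E3) = p ^+ 2 * (E2 * E3) by ring.
congr (_ * _); rewrite /E0 /E1 /E2 /E3 -!expRD; congr expR.
have s1E : s1 ^+ 2 = sigma ^+ 2 - s0 ^+ 2 by rewrite sgE; ring.
have -> : - (s0 * s1 / sigma * v + (m0 - s0 ^+ 2 / sigma * w) - m0) ^+ 2
    / (s0 ^+ 2 *+ 2) = - (s1 * v - s0 * w) ^+ 2 / (sigma ^+ 2 *+ 2).
  by field; rewrite !gt_eqF.
have -> : sigma * w
    + (s0 * s1 / sigma * v + (m0 - s0 ^+ 2 / sigma * w) + (m1 - m0)) - m1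
    = s1 / sigma * (s1 * w + s0 * v).
  have -> : s1 / sigma * (s1 * w + s0 * v) = s1 ^+ 2 / sigma * w + s0 * s1 / sigma * v.
    by field; rewrite gt_eqF.
  by rewrite s1E; field; rewrite gt_eqF.
have -> : - (s1 / sigma * (s1 * w + s0 * v)) ^+ 2 / (s1 ^+ 2 *+ 2)
   = - (s1 * w + s0 * v) ^+ 2 / (sigma ^+ 2 *+ 2).
  by field; rewrite !gt_eqF.
have -> : - (s1 * v - s0 * w) ^+ 2 / (sigma ^+ 2 *+ 2) +
   - (s1 * w + s0 * v) ^+ 2 / (sigma ^+ 2 *+ 2) =
   - ((s0 ^+ 2 + s1 ^+ 2) * (v ^+ 2 + w ^+ 2)) / (sigma ^+ 2 *+ 2).
  by field; rewrite gt_eqF.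
by rewrite -sgE; field; rewrite gt_eqF.
Qed.

Local Open Scope ereal_scope.

Let density m0 s0 m1 s1 (A : set (R * R)) (z : R * R) : \bar R :=
  (\1_A z * (normal_pdf m0 s0 z.1 * normal_pdf m1 s1 z.2))%:E.

Let measurable_density m0 s0 m1 s1 A : measurable A ->
  measurable_fun setT (density m0 s0 m1 s1 A).
Proof.
move=> mA; apply/measurable_EFinP; apply: measurable_funM => //.
by apply: measurable_funM; apply: measurableT_comp => //; exact: measurable_normal_pdf.
Qed.

Let density_ge0 m0 s0 m1 s1 A z : 0 <= density m0 s0 m1 s1 A z.
Proof. by rewrite lee_fin !mulr_ge0// normal_pdf_ge0. Qed.

(** The iterated Lebesgue form allows one coordinate to be substituted at a time. *)
Let normal_probM m0 s0 m1 s1 A : measurable A ->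
  (normal_prob m0 s0 \x normal_prob m1 s1) A =
  \int[mu]_x \int[mu]_y density m0 s0 m1 s1 A (x, y).
Proof.
move=> mA; rewrite /product_measure1 ge0_integral_normal_prob//=; last first.
  exact: measurable_fun_xsection.
apply: eq_integral => x _.
rewrite muleC /normal_prob integral_mkcond -ge0_integralZl//=.
- apply: eq_integral => y _; rewrite /density patchE mem_xsection indicE/=.
  by case: (_ \in A); rewrite ?mul1r ?mul0r ?mule0// EFinM.
- apply/(measurable_restrictT _ _).1 => //; first exact: measurable_xsection.
  apply/measurable_EFinP/measurable_funTS; exact: measurable_normal_pdf.
- by move=> y _; rewrite patchE; case: ifPn => // _; rewrite lee_fin normal_pdf_ge0.
- by rewrite lee_fin normal_pdf_ge0.
Qed.

Let integralZl_mu (f : R -> \bar R) (k : R) : measurable_fun setT f ->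
  (forall x, 0 <= f x) -> (0 <= k)%R ->
  \int[mu]_x (k%:E * f x) = k%:E * \int[mu]_x f x.
Proof. by move=> mf f0 k0; exact: ge0_integralZl. Qed.

Let tonelli_mu (K : measurableTypeR R * measurableTypeR R -> \bar R) :
  measurable_fun setT K -> (forall z, 0 <= K z) ->
  [/\ measurable_fun setT (fun x => \int[mu]_y K (x, y)),
      measurable_fun setT (fun y => \int[mu]_x K (x, y)) &
      \int[mu]_x \int[mu]_y K (x, y) = \int[mu]_y \int[mu]_x K (x, y)].
Proof.
move=> mK K0; split.
- exact: (measurable_fun_fubini_tonelli_F K).
- exact: (measurable_fun_fubini_tonelli_G K).
- exact: (fubini_tonelli K).
Qed.

(* [z.1] is the centred and standardized difference of the two observations,
   [z.2] their centred and standardized inverse-variance weighted mean. *)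
Lemma normal_prob_rotation m0 m1 s0 s1 sigma (A : set (R * R)) :
  (0 < s0)%R -> (0 < s1)%R -> (0 < sigma)%R ->
  (sigma ^+ 2 = s0 ^+ 2 + s1 ^+ 2)%R -> measurable A ->
  (normal_prob m0 s0 \x normal_prob m1 s1) A =
  (normal_prob 0 1 \x normal_prob 0 1) [set z : R * R |
    let x := (s0 * s1 / sigma * z.2 + (m0 - s0 ^+ 2 / sigma * z.1))%R in
    A (x, sigma * z.1 + (x + (m1 - m0)))%R].
Proof.
move=> s00 s10 sg0 sgE mA.
have c0 : (0 < s0 * s1 / sigma)%R by rewrite divr_gt0// mulr_gt0.
have sg0' := ltW sg0; have c0' := ltW c0.
set X := fun z : R * R => (s0 * s1 / sigma * z.2 + (m0 - s0 ^+ 2 / sigma * z.1))%R.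
set Y := fun z : R * R => (sigma * z.1 + (X z + (m1 - m0)))%R.
set B := [set z | _]; set H := density m0 s0 m1 s1 A.
have mX : measurable_fun setT X.
  apply: measurable_funD; first exact: measurable_funM.
  by apply: measurable_funB => //; exact: measurable_funM.
have mY : measurable_fun setT Y.
  apply: measurable_funD; first exact: measurable_funM.
  exact: measurable_funD.
have mXY : measurable_fun setT (fun z => (X z, Y z)) by exact: measurable_fun_pair.
have mB : measurable B.
  by rewrite -[B]setTI; apply: mXY.
rewrite (normal_probM m0 s0 m1 s1 A mA) (normal_probM 0 1 0 1 B mB) -/H.
have mH : measurable_fun setT H by exact: measurable_density.
pose K (z : R * R) := H (z.1, sigma * z.2 + (z.1 + (m1 - m0)))%R.
have mK : measurable_fun setT K.
  apply: measurableT_comp => //; apply: measurable_fun_pair => //.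
  apply: measurable_funD; first exact: measurable_funM.
  exact: measurable_funD.
have K0 z : 0 <= K z by exact: density_ge0.
(* At fixed [x], substitute [y = sigma * w + (x + (m1 - m0))]. *)
transitivity (\int[mu]_x (sigma%:E * \int[mu]_w K (x, w))).
  apply: eq_integral => x _.
  rewrite (ge0_integral_affine sigma (x + (m1 - m0)) (fun y => H (x, y)))//.
    exact: measurableT_comp.
  by move=> y; exact: density_ge0.
have [mF mG KE] := tonelli_mu K mK K0.
(* Tonelli makes [x] the inner variable, so that it can be replaced by an affine function of [v] at
   fixed [w]. *)
rewrite (integralZl_mu _ _ mF (fun=> integral_ge0 _ (fun _ _ => K0 _)) sg0') KE.
rewrite -(integralZl_mu _ _ mG (fun=> integral_ge0 _ (fun _ _ => K0 _)) sg0').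
apply: eq_integral => w _.
have mKw : measurable_fun setT (fun x => K (x, w)) by exact: measurableT_comp.
have mKwv : measurable_fun setT (fun v : R =>
    K (s0 * s1 / sigma * v + (m0 - s0 ^+ 2 / sigma * w), w)%R).
  exact: (measurableT_comp mKw (measurable_affine _ _)).
rewrite (ge0_integral_affine _ (m0 - s0 ^+ 2 / sigma * w) (fun x => K (x, w)) c0 mKw
  (fun=> K0 _)).
rewrite muleA -EFinM -(integralZl_mu _ _ mKwv (fun=> K0 _) (mulr_ge0 sg0' c0')).
apply: eq_integral => v _.
rewrite /K /H /density/= -!EFinM; congr EFin.
rewrite !indicE.
have -> : ((s0 * s1 / sigma * v + (m0 - s0 ^+ 2 / sigma * w),
    sigma * w + (s0 * s1 / sigma * v + (m0 - s0 ^+ 2 / sigma * w) + (m1 - m0)))%R \in A)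
    = ((w, v) \in B) by [].
rewrite -(normal_pdf_rotation m0 m1 s0 s1 sigma w v s00 s10 sg0 sgE).
by field; rewrite gt_eqF.
Qed.

End normal_pair.

(** * The standard normal distribution function *)

Section standard_normal.
Context {R : realType}.
Local Notation mu := (@lebesgue_measure R).
Local Notation N := (@normal_prob R 0 1).
Implicit Types x y L : R.

Lemma phi_expR x : phi x = normal_peak 1 * expR (- x ^+ 2 / 2).
Proof.
by rewrite /phi normal_pdfE ?oner_eq0// /normal_fun subr0 expr1n.
Qed.

Lemma phi_gt0 x : 0 < phi x.
Proof. by rewrite phi_expR mulr_gt0 ?expR_gt0// normal_peak_gt0 ?oner_eq0. Qed.

Lemma phi_le_abs x y : `|x| <= `|y| -> phi y <= phi x.
Proof.
move=> xy; rewrite !phi_expR ler_wpM2l ?normal_peak_ge0// ler_expR.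
rewrite ler_wpM2r// lerN2 -real_normK ?num_real// -[leRHS]real_normK ?num_real//.
by rewrite ler_sqr ?nnegrE.
Qed.

Lemma phi_le_peak x : phi x <= normal_peak 1.
Proof. by apply: normal_pdf_ub; rewrite oner_eq0. Qed.

Lemma phiN x : phi (- x) = phi x.
Proof. by rewrite !phi_expR sqrrN. Qed.

Lemma measurable_phi (D : set R) : measurable_fun D phi.
Proof. by apply: measurable_funTS; exact: measurable_normal_pdf. Qed.

Lemma EFin_Phi x : (Phi x)%:E = N `]-oo, x].
Proof. by rewrite /Phi fineK// fin_num_measure. Qed.

Lemma integral_phi_itvoc x y : x <= y ->
  (\int[mu]_(u in `]x, y]) (phi u)%:E)%E = (Phi y - Phi x)%:E.
Proof.
move=> xy; rewrite EFinB !EFin_Phi.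
rewrite [LHS](_ : _ = N `]x, y])//.
have -> : `]x, y]%classic = `]-oo, y] `\` `]-oo, x].
  apply/seteqP; split => z/=; rewrite !in_itv/=.
    by move=> /andP[xz ->]; split => //; apply/negP; rewrite -ltNge.
  by move=> [-> /negP]; rewrite -ltNge => ->.
rewrite measureD//=.
  by rewrite setIidr// => z/=; rewrite !in_itv/= => /le_trans; exact.
by rewrite ltey_eq fin_num_measure.
Qed.

Lemma normal_prob_itvcc x y : x <= y -> N `[x, y] = (Phi y - Phi x)%:E.
Proof.
move=> xy; rewrite -integral_phi_itvoc// /normal_prob integral_itv_obnd_cbnd//.
by apply/measurable_EFinP; exact: measurable_phi.
Qed.

Lemma Phi_nondecreasing : {homo Phi : x y / x <= y :> R}.
Proof.
move=> x y xy; rewrite -lee_fin !EFin_Phi le_measure ?inE//= => z/=.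
by rewrite !in_itv/= => /le_trans; exact.
Qed.

Lemma measurable_Phi : measurable_fun setT (@Phi R).
Proof. by apply: nondecreasing_measurable => // x y; exact: Phi_nondecreasing. Qed.

Lemma Phi_increasing x y : x < y -> Phi x < Phi y.
Proof.
move=> xy; rewrite -subr_gt0 -lte_fin -integral_phi_itvoc ?ltW//.
(* [phi z] is a positive lower bound of the density on all of []x, y]]. *)
pose z := Num.max `|x| `|y|.
apply: (@lt_le_trans _ _ (\int[mu]_(u in `]x, y]) (cst (phi z)%:E u))%E).
  rewrite integral_cst//= lebesgue_measure_itv/= lte_fin xy -EFinB -EFinM lte_fin.
  by rewrite mulr_gt0 ?phi_gt0// subr_gt0.
apply: ge0_le_integral => //.
- by move=> u _; rewrite lee_fin ltW ?phi_gt0.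
- by apply/measurable_EFinP; exact: measurable_phi.
- move=> u /=; rewrite in_itv/= => /andP[xu uy]; rewrite lee_fin phi_le_abs//.
  rewrite [leRHS]ger0_norm; last by rewrite le_max normr_ge0.
  rewrite le_max; have [u0|u0] := leP 0 u.
    by rewrite (ger0_norm u0) (le_trans uy (ler_norm _)) orbT.
  by rewrite (ltr0_norm u0) -normrN (le_trans _ (ler_norm (- x)))// lerN2 ltW.
Qed.

Lemma Phi_lipschitz x y : x <= y -> Phi y - Phi x <= normal_peak 1 * (y - x).
Proof.
move=> xy; rewrite -lee_fin -integral_phi_itvoc//.
apply: (@le_trans _ _ (\int[mu]_(u in `]x, y]) (cst (normal_peak 1)%:E u))%E).
  apply: ge0_le_integral => //.
  - by move=> u _; rewrite lee_fin ltW ?phi_gt0.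
  - by apply/measurable_EFinP; exact: measurable_phi.
  - by move=> u _; rewrite lee_fin phi_le_peak.
rewrite integral_cst//= lebesgue_measure_itv/= lte_fin.
case: ifPn => _; first by rewrite -EFinB -EFinM.
by rewrite mule0 lee_fin mulr_ge0 ?normal_peak_ge0// subr_ge0.
Qed.

Lemma ge0_integral_normal01N (f : R -> \bar R) :
  measurable_fun setT f -> (forall x, (0 <= f x)%E) ->
  (\int[N]_x f x = \int[N]_x f (- x)%R)%E.
Proof.
move=> mf f0; rewrite !ge0_integral_normal_prob//; last first.
  by apply: measurableT_comp => //; exact: oppr_measurable.
have mfphi : measurable_fun setT (fun x => f x * (phi x)%:E)%E.
  by apply: emeasurable_funM => //; apply/measurable_EFinP; exact: measurable_phi.
have fphi0 x : (0 <= f x * (phi x)%:E)%E by rewrite mule_ge0// lee_fin ltW ?phi_gt0.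
apply: (etrans (ge0_integralN _ mfphi fphi0)).
by apply: eq_integral => x _; rewrite phiN.
Qed.

(** Reflection carries []-oo, - x]] to [[x, +oo[], whose endpoint has no mass, which leaves the
    complement of []-oo, x]]. *)
Lemma PhiN x : Phi (- x) = 1 - Phi x.
Proof.
apply/EFin_inj; rewrite EFinB !EFin_Phi.
have -> : N `]-oo, (- x)%R] = N `[x, +oo[.
  have NE (A : set R) : measurable A -> N A = (\int[N]_u (\1_A u)%:E)%E.
    by move=> mA; rewrite integral_indic// setIT.
  rewrite !NE// ge0_integral_normal01N//; last first.
    by apply/measurable_EFinP; exact: measurable_indic.
  by apply: eq_integral => u _; rewrite !indicE !mem_setE/= !in_itv/= andbT lerN2.
have -> : N `[x, +oo[ = N `]x, +oo[.
  rewrite /normal_prob integral_itv_obnd_cbnd//.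
  by apply/measurable_EFinP; exact: measurable_phi.
by rewrite -setCitvl (probability_setC N).
Qed.

(** Both sides are integrals over []x, y]], of [phi (u + L)] and [phi (u - L)]. For [u >= 0] one has
    [|u - L| <= u + L], and [phi] decreases in the absolute value. *)
Lemma Phi_window_decreasing L x y : 0 <= L -> 0 <= x -> x <= y ->
  Phi (y + L) - Phi (x + L) <= Phi (y - L) - Phi (x - L).
Proof.
move=> L0 x0 xy.
have shift a : (Phi (y + a) - Phi (x + a))%:E =
    (\int[mu]_u ((phi (1 * u + a) * \1_`]x, y] u)%:E))%E.
  rewrite -integral_phi_itvoc ?lerD2r// integral_mkcond.
  set f := (_ \_ _).
  have f0 u : (0 <= f u)%E.
    by rewrite /f patchE; case: ifPn => // _; rewrite lee_fin ltW ?phi_gt0.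
  have mf : measurable_fun setT f.
    apply/(measurable_restrictT _ _).1 => //; apply/measurable_EFinP.
    exact: measurable_phi.
  rewrite (ge0_integral_affine 1 a f)// mul1e; apply: eq_integral => u _.
  rewrite /f patchE indicE !mem_setE/= !in_itv/= mul1r ltrD2r lerD2r.
  by case: ifPn => _; rewrite ?mulr1 ?mulr0.
have mphi (a : R) :
    measurable_fun setT (fun u : R => (phi (1 * u + a) * \1_`]x, y] u)%:E).
  apply/measurable_EFinP/measurable_funM => //.
  by apply: (measurableT_comp (measurable_phi setT)); exact: (measurable_affine 1 a).
rewrite -lee_fin !shift; apply: ge0_le_integral => //; try exact: mphi.
- by move=> u _; rewrite lee_fin mulr_ge0// ltW ?phi_gt0.
- move=> u _; rewrite lee_fin indicE mem_setE/= in_itv/= mul1r.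
  case: (boolP (_ && _)) => [/andP[xu uy]|_]; last by rewrite !mulr0.
  rewrite !mulr1 phi_le_abs// [leRHS]ger0_norm ?ler_norml; last lra.
  by apply/andP; split; lra.
Qed.

(** * Mass of a shifted symmetric interval *)

Definition window L x : R := Phi (L - x) - Phi (- L - x).

Lemma windowE L x : window L x = Phi (x + L) - Phi (x - L).
Proof.
rewrite /window; have -> : L - x = - (x - L) by ring.
by have -> : - L - x = - (x + L) by [ring]; rewrite !PhiN; ring.
Qed.

Lemma windowN L x : window L (- x) = window L x.
Proof. by rewrite windowE /window (addrC _ L) (addrC _ (- L)). Qed.

Lemma window0 x : window 0 x = 0.
Proof. by rewrite /window oppr0 subrr. Qed.

Lemma EFin_window L x : 0 <= L ->
  N [set v | `|v + x| <= L] = (window L x)%:E.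
Proof.
move=> L0; rewrite -normal_prob_itvcc; last by rewrite lerD2r; lra.
congr (N _); apply/seteqP; split => v /=; rewrite in_itv/= ler_norml;
  by move=> /andP[? ?]; apply/andP; split; lra.
Qed.

Lemma window_ge0 L x : 0 <= L -> 0 <= window L x.
Proof. by move=> L0; rewrite -lee_fin -EFin_window. Qed.

(** For [L >= 0] this is a probability, and [window] is odd in [L]. Negative [L] is covered so that
    the coverage is defined and continuous on the whole line. *)
Lemma window_abs_le1 L x : `|window L x| <= 1.
Proof.
have le1 M : 0 <= M -> window M x <= 1.
  move=> M0; rewrite -lee_fin -EFin_window//; apply: probability_le1.
  rewrite [X in measurable X](_ : _ = `[- M - x, M - x]%classic)//.
  apply/seteqP; split => v /=; rewrite in_itv/= ler_norml;
    by move=> /andP[? ?]; apply/andP; split; lra.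
have [L0|/ltW L0] := leP 0 L; first by rewrite ger0_norm ?window_ge0// le1.
have -> : window L x = - window (- L) x by rewrite /window opprK opprB.
by rewrite normrN ger0_norm ?window_ge0 ?le1 ?oppr_ge0.
Qed.

Lemma window_le_abs L x y : 0 <= L -> `|x| <= `|y| -> window L y <= window L x.
Proof.
have wabs z : window L z = window L `|z|.
  by have [z0|z0] := leP 0 z; [rewrite ger0_norm|rewrite ltr0_norm// windowN].
move=> L0 xy; rewrite (wabs x) (wabs y) !windowE.
have := Phi_window_decreasing L `|x| `|y| L0 (normr_ge0 x) xy; lra.
Qed.

Lemma window_increasing L1 L2 x : L1 < L2 -> window L1 x < window L2 x.
Proof.
move=> L12; rewrite /window.
have : Phi (L1 - x) < Phi (L2 - x) by apply: Phi_increasing; rewrite ltrD2r.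
have : Phi (- L2 - x) < Phi (- L1 - x) by apply: Phi_increasing; rewrite ltrD2r ltrN2.
lra.
Qed.

(** Each of the two endpoints moves by [L2 - L1], through a density of at most [normal_peak 1]. *)
Lemma window_lipschitz L1 L2 x : L1 <= L2 ->
  window L2 x - window L1 x <= 2 * normal_peak 1 * (L2 - L1).
Proof.
move=> L12; rewrite /window.
have : Phi (L2 - x) - Phi (L1 - x) <= normal_peak 1 * (L2 - x - (L1 - x)).
  by apply: Phi_lipschitz; rewrite lerD2r.
have : Phi (- L1 - x) - Phi (- L2 - x) <= normal_peak 1 * (- L1 - x - (- L2 - x)).
  by apply: Phi_lipschitz; rewrite lerD2r lerN2.
lra.
Qed.

Lemma measurable_window L : measurable_fun setT (window L).
Proof.
apply: measurable_funB; apply: (measurableT_comp measurable_Phi);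
  exact: measurable_funB.
Qed.

End standard_normal.

(** * Strict positivity and tightness under a probability *)

Section probability_integrals.
Context d (T : measurableType d) (R : realType) (P : probability T R).

(** If the integral vanished, [f] would be zero almost everywhere; as it is zero nowhere, the whole
    space would be null. *)
Lemma Rintegral_probability_gt0 (f : T -> R) : P.-integrable setT (EFin \o f) ->
  (forall x, 0 < f x) -> 0 < \int[P]_x f x.
Proof.
move=> fi f0; have mf := measurable_int _ fi.
rewrite lt_neqAle Rintegral_ge0 ?andbT; last by move=> x _; exact: ltW.
apply/eqP => I0.
have : (\int[P]_x `|(f x)%:E| = 0)%E.
  under eq_integral do rewrite gee0_abs ?lee_fin ?ltW//.
  by rewrite -(fineK (integrable_fin_num measurableT fi)) -/(Rintegral _ _ _) -I0.
move/(ae_eq_integral_abs P measurableT mf) => [A [mA A0 fA]].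
have AT : A = setT.
  rewrite -subTset => x _; apply: fA => /= /(_ I) [fx0].
  by have := f0 x; rewrite fx0 ltxx.
have := etrans (esym (congr1 P AT)) A0.
by rewrite probability_setT => /eqP; rewrite onee_eq0.
Qed.

Lemma Rintegral_probability_cst (r : R) : \int[P]_x r = r.
Proof.
rewrite Rintegral_cst//.
by have := congr1 fine (probability_setT P); rewrite /= => ->; rewrite mulr1.
Qed.

(** The distribution function of [|X|] tends to 1 at infinity, so it eventually exceeds [p]. *)
Lemma probability_tight (X : T -> R) (p : R) : measurable_fun setT X -> p < 1 ->
  exists2 M : R, 0 <= M & (p%:E <= P [set x | (`|X x| <= M)%R])%E.
Proof.
move=> mX p1.
have mXn : measurable_fun setT (fun x => `|X x|) by exact: measurableT_comp.
pose Y : {RV P >-> R} :=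
  HB.pack (fun x => `|X x|) (isMeasurableFun.Build _ _ _ _ _ mXn).
have : nbhs (1%E : \bar R) [set y | (p%:E < y)%E].
  apply: open_nbhs_nbhs; split; first exact: open_ereal_gt_ereal.
  by rewrite /= lte_fin.
move=> /(cvg_cdfy1 Y)[M [_ HM]]; pose M' := Num.max 0 (M + 1).
exists M'; first by rewrite le_max lexx.
have MM' : M < M' by rewrite lt_max ltrDl ltr01 orbT.
by have := HM _ MM'; rewrite /cdf /distribution /pushforward/= => /ltW.
Qed.

End probability_integrals.

Local Ltac split_ifs := repeat match goal with
  |- context [if ?x <= ?y then _ else _] => case: (leP x y) => ? end.

(** * The clipped residual and the coverage as a function of bias and length *)

Section soft_threshold.
Context {R : realType}.
Local Notation mu := (@lebesgue_measure R).
Local Notation N := (@normal_prob R 0 1).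
Implicit Types c m w k L x : R.

Definition clip c x := Num.max (- c) (Num.min c x).
(** The quantity [h] of the overview: [w] is the noise in the standardized difference and [m] its
    mean. *)
Definition resid c m w := clip c (w + m) - w.

Lemma clipE c x : 0 <= c ->
  clip c x = if x <= - c then - c else if x <= c then x else c.
Proof.
by move=> c0; rewrite /clip minEle maxEle; case: (leP c x) => ?; split_ifs; lra.
Qed.

Lemma clipZ c x k : 0 <= k -> clip (k * c) (k * x) = k * clip c x.
Proof. by move=> k0; rewrite /clip maxr_pMr// minr_pMr// mulrN. Qed.

Lemma measurable_clip c : measurable_fun setT (clip c).
Proof. by apply: measurable_maxr => //; exact: measurable_minr. Qed.

Lemma residN c m w : 0 <= c -> resid c (- m) w = - resid c m (- w).
Proof. by move=> c0; rewrite /resid !clipE//; split_ifs; lra. Qed.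

Lemma resid_inside c m w : - c - m <= w <= c - m -> resid c m w = m.
Proof.
by move=> /andP[? ?]; rewrite /resid clipE; [split_ifs; lra|lra].
Qed.

Lemma resid_below c m w : 0 <= c -> w <= - c - m -> resid c m w = - c - w.
Proof. by move=> c0 ?; rewrite /resid clipE//; split_ifs; lra. Qed.

Lemma resid_above c m w : 0 <= c -> c - m <= w -> resid c m w = c - w.
Proof. by move=> c0 ?; rewrite /resid clipE//; split_ifs; lra. Qed.

(* [resid c m w] is the projection of [m] onto the interval
   [[- c - w, c - w]]; as [m] moves away from [0] on one side, the projection
   moves monotonically and stops at its endpoint before it can cross [0]. *)
Lemma resid_le_norm c m1 m2 w : 0 <= c -> 0 <= m1 -> m1 <= m2 ->
  `|resid c m1 w| <= `|resid c m2 w|.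
Proof.
have absE z : `|z| = if 0 <= z then z else - z :> R.
  by case: leP => z0; [rewrite ger0_norm|rewrite ltr0_norm].
move=> c0 m10 m12; rewrite /resid !clipE//.
by split_ifs; rewrite !absE; split_ifs; lra.
Qed.

Lemma measurable_resid c m : measurable_fun setT (resid c m).
Proof.
apply: measurable_funB => //; apply: (measurableT_comp (measurable_clip c)).
exact: measurable_funD.
Qed.

(* Locked, lest comparing two coverages unfold the integral. *)
Definition coverage : R -> R -> R -> R -> R :=
  locked (fun k c m L => \int[N]_w window L (k * resid c m w)).

Lemma coverageE k c m L :
  coverage k c m L = \int[N]_w window L (k * resid c m w).
Proof. by rewrite /coverage -lock. Qed.

Lemma measurable_window_resid k c m L :
  measurable_fun setT (fun w => window L (k * resid c m w)).
Proof.
apply: (measurableT_comp (measurable_window L)).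
by apply: measurable_funM => //; exact: measurable_resid.
Qed.

Lemma integrable_window_resid k c m L :
  N.-integrable setT (EFin \o (fun w => window L (k * resid c m w))).
Proof.
apply: (le_integrable measurableT _ _
  (finite_measure_integrable_cst N 1 measurableT)).
  by apply/measurable_EFinP; exact: measurable_window_resid.
by move=> w _ /=; rewrite lee_fin normr1 window_abs_le1.
Qed.

Lemma EFin_coverage k c m L :
  (coverage k c m L)%:E = (\int[N]_w (window L (k * resid c m w))%:E)%E.
Proof.
by rewrite coverageE fineK// integrable_fin_num//; exact: integrable_window_resid.
Qed.

(** The section of the event at a fixed first coordinate [w] has mass
    [window L (k * resid c m w)]. *)
Lemma coverage_prob k c m L : 0 <= L ->
  (N \x N)%E [set z : R * R | `|z.2 + k * resid c m z.1| <= L] =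
  (coverage k c m L)%:E.
Proof.
move=> L0; rewrite EFin_coverage//; apply: eq_integral => w _ /=.
rewrite -EFin_window//; congr (N _).
by apply/seteqP; split => v; rewrite /xsection/= inE.
Qed.

Lemma coverageN k c m L : 0 <= c -> 0 <= L ->
  coverage k c (- m) L = coverage k c m L.
Proof.
move=> c0 L0; apply/EFin_inj.
rewrite (EFin_coverage k c (- m) L) (EFin_coverage k c m L).
rewrite [RHS](ge0_integral_normal01N (fun w => (window L (k * resid c m w))%:E)).
- by apply: eq_integral => w _; rewrite residN// mulrN windowN.
- by apply/measurable_EFinP; exact: measurable_window_resid.
- by move=> w; rewrite lee_fin window_ge0.
Qed.

Lemma coverage_le_norm k c m1 m2 L : 0 <= c -> 0 <= L -> `|m1| <= `|m2| ->
  coverage k c m2 L <= coverage k c m1 L.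
Proof.
move=> c0 L0 m12.
(* Evenness reduces the claim to nonnegative [m], where the integrands compare pointwise in [w]. *)
have covE m : coverage k c m L = coverage k c `|m| L.
  case: (leP 0 m) => m0; first by rewrite ger0_norm.
  by rewrite ltr0_norm//; exact/esym/coverageN.
rewrite (covE m1) (covE m2).
rewrite !coverageE; apply: le_Rintegral => //; try exact: integrable_window_resid.
by move=> w _; rewrite window_le_abs// !normrM ler_wpM2l// resid_le_norm.
Qed.

Lemma coverage0 k c m : coverage k c m 0 = 0.
Proof.
rewrite coverageE; under eq_Rintegral do rewrite window0.
by rewrite Rintegral_probability_cst.
Qed.

Lemma coverage_increasing k c m L1 L2 : L1 < L2 ->
  coverage k c m L1 < coverage k c m L2.
Proof.
move=> L12.
have i1 := integrable_window_resid k c m L1.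
have i2 := integrable_window_resid k c m L2.
rewrite -subr_gt0 !coverageE -RintegralB//.
apply: Rintegral_probability_gt0; first exact: (integrableB measurableT i2 i1).
by move=> w; rewrite subr_gt0 window_increasing.
Qed.

Lemma coverage_nondecreasing k c m L1 L2 : L1 <= L2 ->
  coverage k c m L1 <= coverage k c m L2.
Proof. by rewrite le_eqVlt => /predU1P[->//|/coverage_increasing-/(_ k c m)/ltW]. Qed.

Lemma coverage_lipschitz k c m L1 L2 : L1 <= L2 ->
  coverage k c m L2 - coverage k c m L1 <= 2 * normal_peak 1 * (L2 - L1).
Proof.
move=> L12.
have i1 := integrable_window_resid k c m L1.
have i2 := integrable_window_resid k c m L2.
rewrite !coverageE -RintegralB//.
have -> : 2 * normal_peak 1 * (L2 - L1) =
    \int[N]_w (2 * normal_peak 1 * (L2 - L1)).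
  by rewrite Rintegral_probability_cst.
apply: le_Rintegral => //.
- exact: (integrableB measurableT i2 i1).
- exact: finite_measure_integrable_cst.
- by move=> w _; exact: window_lipschitz.
Qed.

(** Tightness of the real random variable [z.2 + k * resid c m z.1], whose absolute value is at most
    [L] with probability [coverage k c m L]. *)
Lemma coverage_large k c m (p : R) : p < 1 ->
  exists2 L, 0 <= L & p <= coverage k c m L.
Proof.
move=> p1.
have mX : measurable_fun setT (fun z : R * R => z.2 + k * resid c m z.1).
  apply: measurable_funD => //; apply: measurable_funM => //.
  by apply: (measurableT_comp (measurable_resid c m)).
have [M M0 pM] := probability_tight _ _ _ (N \x N)%E _ _ mX p1.
by exists M => //; rewrite -lee_fin -(coverage_prob k c m M M0).
Qed.

Lemma continuous_coverage k c m : continuous (coverage k c m).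
Proof.
move=> L; apply/cvgrPdist_lt => e e0; have K0 := @normal_peak_gt0 R 1 (oner_neq0 R).
(* The radius is [e] divided by the Lipschitz constant. *)
apply/nbhs_ballP; exists (e / (2 * normal_peak 1)).
  by rewrite /= divr_gt0// mulr_gt0.
move=> L'; rewrite /ball/= ltr_pdivlMr ?mulr_gt0//; apply: le_lt_trans.
wlog LL : L L' / L <= L' => [H|].
  by case: (leP L L') => LL; [|rewrite distrC (distrC L)]; apply: H; lra.
rewrite distrC (distrC L) !ger0_norm ?subr_ge0//.
  by rewrite [leRHS]mulrC coverage_lipschitz.
by rewrite coverage_nondecreasing.
Qed.

(** Intermediate value theorem between [L = 0], with coverage 0, and an [M] whose coverage is at
    least [p]. *)
Lemma coverage_root k c m (p : R) : 0 <= p < 1 ->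
  exists2 L, 0 <= L & coverage k c m L = p.
Proof.
move=> /andP[p0 p1]; have [M M0 pM] := coverage_large k c m p p1.
have := @IVT _ (coverage k c m) _ _ p M0
  (continuous_subspaceT (continuous_coverage k c m)).
rewrite coverage0 ge_min le_max p0 pM orbT => /(_ isT)[L].
by rewrite in_itv/= => /andP[L0 _] LE; exists L.
Qed.

End soft_threshold.

(** * The explicit coverage formula and the sign of the critical value *)

Section coverage_formula.
Context {R : realType}.
Local Notation mu := (@lebesgue_measure R).
Local Notation N := (@normal_prob R 0 1).

Let Rintegral_mu_setU (A B : set R) (f : R -> R) :
  measurable A -> measurable B -> mu.-integrable (A `|` B) (EFin \o f) ->
  [disjoint A & B] ->
  \int[mu]_(x in A `|` B) f x = \int[mu]_(x in A) f x + \int[mu]_(x in B) f x.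
Proof. by move=> mA mB fi AB; exact: Rintegral_setU. Qed.

(** Cutting at [- c - m] and [c - m] makes the residual explicit: [- c - u] on the left, the
    constant [m] in the middle, [c - u] on the right. *)
Lemma coverage_split (k c m L : R) : 0 <= c -> 0 <= L ->
  coverage k c m L =
    (Phi (c - m) - Phi (- c - m)) * window L (k * m)
  + \int[mu]_(u in `]-oo, - c - m]) (window L (k * (- c - u)) * phi u)
  + \int[mu]_(u in `[c - m, +oo[) (window L (k * (c - u)) * phi u).
Proof.
move=> c0 L0; pose f u := window L (k * resid c m u) * phi u.
have phii : mu.-integrable setT (EFin \o (@phi R)) by exact: integrable_normal_pdf.
have fi : mu.-integrable setT (EFin \o f).
  apply: (le_integrable measurableT _ _ phii).
    apply/measurable_EFinP/measurable_funM; last exact: measurable_phi.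
    exact: measurable_window_resid.
  by move=> u _ /=; rewrite lee_fin normrM ler_piMl ?window_abs_le1 ?normr_ge0.
have fiD (D : set R) : measurable D -> mu.-integrable D (EFin \o f).
  by move=> mD; exact: integrableS fi.
have -> : coverage k c m L = \int[mu]_u f u.
  apply/EFin_inj; rewrite (EFin_coverage k c m L) ge0_integral_normal_prob.
  - by rewrite fineK ?integrable_fin_num//; apply: eq_integral => u _; rewrite -EFinM.
  - by apply/measurable_EFinP; exact: measurable_window_resid.
  - by move=> u; rewrite lee_fin window_ge0.
have mc : - c - m <= c - m by lra.
have setTE : [set: R] = (`]-oo, - c - m] `|` `]- c - m, c - m]) `|` `]c - m, +oo[.
  apply/seteqP; split => // u _ /=; rewrite !in_itv/= andbT.
  have [|?] := leP u (- c - m); first by left; left.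
  by have [?|] := leP u (c - m); [left; right|right].
have d1 : [disjoint (`]-oo, (- c - m)] `|` `](- c - m), (c - m)] : set R) &
    `](c - m), +oo[%classic].
  apply/disj_setPS => u [[]/=]; rewrite !in_itv/= ?andbT.
    by move=> u1 u2; lra.
  by move=> /andP[u1 u2] u3; lra.
have d2 : [disjoint (`]-oo, (- c - m)] : set R) & `](- c - m), (c - m)]%classic].
  by apply/disj_setPS => u [/=]; rewrite !in_itv/= => u1 /andP[u2 u3]; lra.
have m12 : measurable (`]-oo, (- c - m)] `|` `](- c - m), (c - m)] : set R).
  exact: measurableU.
have -> : \int[mu]_u f u = \int[mu]_(u in `]-oo, - c - m]) f u
    + \int[mu]_(u in `]- c - m, c - m]) f u + \int[mu]_(u in `]c - m, +oo[) f u.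
  transitivity (\int[mu]_(u in (`]-oo, (- c - m)] `|` `](- c - m), (c - m)])
      `|` `](c - m), +oo[) f u); first by rewrite -setTE.
  rewrite (Rintegral_mu_setU _ _ _ m12 _ _ d1)//; last by rewrite -setTE.
  by rewrite (Rintegral_mu_setU _ _ _ _ _ (fiD _ m12) d2).
(* The partition uses the open half-line; adding its endpoint leaves the integral unchanged. *)
rewrite (@Rintegral_itv_obnd_cbnd _ (c - m) +oo%O); last by apply: fiD.
have -> : \int[mu]_(u in `]- c - m, c - m]) f u =
    (Phi (c - m) - Phi (- c - m)) * window L (k * m).
  transitivity (\int[mu]_(u in `]- c - m, c - m]) (window L (k * m) * phi u)).
    apply: eq_Rintegral => u /[!inE]/=; rewrite in_itv/= => /andP[u1 u2].
    by rewrite /f resid_inside// (ltW u1).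
  rewrite RintegralZl//; last exact: integrableS phii.
  by rewrite mulrC /Rintegral integral_phi_itvoc.
have -> : \int[mu]_(u in `]-oo, - c - m]) f u =
    \int[mu]_(u in `]-oo, - c - m]) (window L (k * (- c - u)) * phi u).
  by apply: eq_Rintegral => u /[!inE]/=; rewrite in_itv/= => u1; rewrite /f resid_below.
have -> : \int[mu]_(u in `[c - m, +oo[) f u =
    \int[mu]_(u in `[c - m, +oo[) (window L (k * (c - u)) * phi u).
  apply: eq_Rintegral => u /[!inE]/=; rewrite in_itv/= andbT => u1.
  by rewrite /f resid_above.
by rewrite [_ * window _ _ + _]addrC.
Qed.

Lemma crit_ge0 (a : R) : 0 < a < 2^-1 -> 0 <= crit a.
Proof.
move=> /andP[a0 a1]; rewrite /crit; set E := [set x | _].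
(* The infimum of the empty set is 0 by convention. *)
have [->|/set0P E0] := eqVneq E set0; first by rewrite inf0.
apply: lb_le_inf => // x; rewrite /E/= => ax; rewrite leNgt; apply/negP => x0.
have : Phi x < Phi 0 by exact: Phi_increasing.
(* Reflection at 0 gives [Phi 0 = 1 / 2], which is below [1 - a]. *)
by have := @PhiN R 0; rewrite oppr0; lra.
Qed.

End coverage_formula.

(** * Reduction of the estimator to standardized coordinates *)

Section estimator.
Context {R : realType} (s0 s1 alpha : R).
Context (s00 : 0 < s0) (s10 : 0 < s1) (alpha01 : 0 < alpha < 1).
Let g := gam s0 s1.
Let c := crit (alpha / 2).
Let sigma := sig s0 s1.

Lemma crit_half_ge0 : 0 <= c.
Proof. by apply: crit_ge0; move: alpha01; lra. Qed.

Lemma gamE : g = (s0 / s1) ^+ 2.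
Proof. by rewrite /g /gam expr_div_n. Qed.

Lemma sqrt_gam : Num.sqrt g = s0 / s1.
Proof. by rewrite gamE sqrtr_sqr ger0_norm// divr_ge0// ltW. Qed.

Lemma sig_gt0 : 0 < sigma.
Proof. by rewrite sqrtr_gt0 addr_gt0// exprn_gt0. Qed.

Lemma sqr_sig : sigma ^+ 2 = s0 ^+ 2 + s1 ^+ 2.
Proof. by rewrite sqr_sqrtr// addr_ge0// sqr_ge0. Qed.

Lemma gam1E : 1 + g = sigma ^+ 2 / s1 ^+ 2.
Proof. by rewrite sqr_sig gamE; field; rewrite gt_eqF. Qed.

Lemma sqrt_gam1 : Num.sqrt (1 + g) = sigma / s1.
Proof.
by rewrite gam1E -expr_div_n sqrtr_sqr ger0_norm// divr_ge0// ltW// sig_gt0.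
Qed.

Lemma gam_ratio : g / (1 + g) = (s0 / sigma) ^+ 2.
Proof. by rewrite gam1E gamE; field; rewrite !gt_eqF// sig_gt0. Qed.

Lemma sqrt_gam_ratio : Num.sqrt (g / (1 + g)) = s0 / sigma.
Proof. by rewrite gam_ratio sqrtr_sqr ger0_norm// divr_ge0// ltW// sig_gt0. Qed.

(** Both branches of the estimator add [g / (1 + g)] times the observed difference clipped to
    [[- sigma * c, sigma * c]]. *)
Lemma tauST_clip (x0 x1 : R) :
  tauST s0 s1 alpha x0 x1 = x0 + g / (1 + g) * (sigma * clip c ((x1 - x0) / sigma)).
Proof.
have sg0 := sig_gt0; have c0 := crit_half_ge0.
rewrite -clipZ ?ltW// [in X in clip _ X]mulrC divfK ?gt_eqF//.
rewrite /tauST -/g -/c -/sigma; set d := x1 - x0.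
have t0 : 0 <= sigma * c by rewrite mulr_ge0// ltW.
rewrite clipE//; have [d1|d1] := leP `|d| (sigma * c).
  move: d1; rewrite ler_norml => /andP[d1 d2]; rewrite d2.
  (* The branches overlap only at [d = - (sigma * c)], where they agree. *)
  by case: (leP d (- (sigma * c))) => // d3; congr (_ + _ * _); lra.
rewrite -mulrA; congr (_ + _ * _).
(* Here [|d| > sigma * c >= 0], so [d] is nonzero and its sign selects the endpoint. *)
have [d0|d0] := leP 0 d.
  rewrite ger0_norm// in d1; rewrite gtr0_sg ?mulr1; last exact: le_lt_trans d1.
  by case: leP => [?|_]; [|case: leP => // ?]; lra.
rewrite ltr0_norm// in d1; rewrite ltr0_sg// mulrN1.
by case: (leP d (- (sigma * c))) => // ?; lra.
Qed.

Lemma covSTE (tau D L : R) : 0 <= L ->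
  covST s0 s1 alpha tau D L = coverage (Num.sqrt g) c (D / sigma) L.
Proof.
move=> L0; have sg0 := sig_gt0; have c0 := crit_half_ge0.
rewrite /covST; set A := [set z | _].
have mA : measurable A.
  pose T (z : R * R) :=
    z.1 + g / (1 + g) * (sigma * clip c ((z.2 - z.1) / sigma)) - tau.
  have mT : measurable_fun setT (fun z => `|T z|).
    apply: measurableT_comp => //; apply: measurable_funB => //.
    apply: measurable_funD => //; apply: measurable_funM => //.
    apply: measurable_funM => //; apply: (measurableT_comp (measurable_clip c)).
    by apply: measurable_funM => //; exact: measurable_funB.
  have -> : A = (fun z => `|T z|) @^-1` `]-oo, L / Num.sqrt (1 + g) * s0].
    by apply/seteqP; split => z; rewrite /A/= in_itv/= tauST_clip.
  by rewrite -[X in measurable X]setTI; exact: mT.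
rewrite (normal_prob_rotation _ _ _ _ sigma A s00 s10 sg0 sqr_sig mA).
rewrite (_ : [set z | _] =
  [set z : R * R | `|z.2 + Num.sqrt g * resid c (D / sigma) z.1| <= L]).
  by rewrite coverage_prob.
apply/seteqP.
have s' : 0 < s0 * s1 / sigma by rewrite divr_gt0// mulr_gt0.
(* The estimation error and the half-length both carry the factor [s0 * s1 / sigma], the standard
   deviation of the precision-weighted mean, which cancels from the event. *)
have E (w v : R) : let x := s0 * s1 / sigma * v + (tau - s0 ^+ 2 / sigma * w) in
    (tauST s0 s1 alpha x (sigma * w + (x + (tau + D - tau))) - tau) =
    s0 * s1 / sigma * (v + Num.sqrt g * resid c (D / sigma) w).
  rewrite /= tauST_clip; set x := _ + (_ - _).
  have -> : (sigma * w + (x + (tau + D - tau)) - x) / sigma = w + D / sigma.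
    by field; rewrite gt_eqF.
  by rewrite /resid gam_ratio sqrt_gam /x; field; rewrite !gt_eqF.
have E2 : L / Num.sqrt (1 + g) * s0 = s0 * s1 / sigma * L.
  by rewrite sqrt_gam1; field; rewrite !gt_eqF.
by split => -[w v]; rewrite /A/= -/g E E2 normrM (gtr0_norm s') ler_pM2l.
Qed.

End estimator.

(** * Symmetry, the formula and the optimal length, read off from [coverage] *)

Theorem theorem3 (R : realType) (s0 s1 alpha : R) :
  0 < s0 -> 0 < s1 -> 0 < alpha < 1 ->
  let g := gam s0 s1 in
  let c := crit (alpha / 2) in
  (* (i) *)
  (forall tau L : R, 0 < L ->
     (forall D : R, covST s0 s1 alpha tau (- D) L = covST s0 s1 alpha tau D L) /\
     (forall D1 D2 : R, `|D1| <= `|D2| ->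
        covST s0 s1 alpha tau D2 L <= covST s0 s1 alpha tau D1 L)) /\
  (* (ii) *)
  (forall tau t L : R, 0 <= L ->
     covST s0 s1 alpha tau (t * s0) L =
       (Phi (c - Num.sqrt (g / (1 + g)) * t) - Phi (- c - Num.sqrt (g / (1 + g)) * t))
       * (Phi (L - g / Num.sqrt (1 + g) * t) - Phi (- L - g / Num.sqrt (1 + g) * t))
     + Rintegral lebesgue_measure `]-oo, - c - Num.sqrt (g / (1 + g)) * t]
         (fun u => (Phi (L + Num.sqrt g * (u + c)) - Phi (- L + Num.sqrt g * (u + c)))
                   * phi u)
     + Rintegral lebesgue_measure `[c - Num.sqrt (g / (1 + g)) * t, +oo[
         (fun u => (Phi (L + Num.sqrt g * (u - c)) - Phi (- L + Num.sqrt g * (u - c)))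
                   * phi u)) /\
  (* (iii) *)
  (forall tau b zeta : R, 0 <= b -> 0 < zeta < 1 ->
     let Lhat := inf [set L : R | 0 <= L /\
                   1 - zeta <= inf [set covST s0 s1 alpha tau D L
                                   | D in [set D : R | `|D / s0| <= b]]] in
     [/\ 0 <= Lhat,
         covST s0 s1 alpha tau (b * s0) Lhat = 1 - zeta,
         (forall L : R, 0 <= L -> covST s0 s1 alpha tau (b * s0) L = 1 - zeta ->
            L = Lhat) &
         (forall L : R, 0 <= L ->
            ((forall D : R, `|D / s0| <= b -> 1 - zeta <= covST s0 s1 alpha tau D L)
             <-> Lhat <= L))]).
Proof.
move=> s00 s10 alpha01 g c.
have c0 : 0 <= c by exact: crit_half_ge0.
have sg0 := sig_gt0 s0 s1 s00 s10.
have covE tau D L : 0 <= L ->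
    covST s0 s1 alpha tau D L = coverage (Num.sqrt g) c (D / sig s0 s1) L.
  by move=> L0; rewrite covSTE.
have cov_le tau D1 D2 L : 0 <= L -> `|D1| <= `|D2| ->
    covST s0 s1 alpha tau D2 L <= covST s0 s1 alpha tau D1 L.
  move=> L0 D12; rewrite covE// [leRHS]covE//; apply: coverage_le_norm => //.
  by rewrite !normrM ler_wpM2r.
split; [|split].
- move=> tau L /ltW L0; split => [D|D1 D2]; last exact: cov_le.
  by rewrite covE// [RHS]covE// mulNr; exact: coverageN.
- move=> tau t L L0; rewrite covE//.
  have -> : Num.sqrt (g / (1 + g)) * t = t * s0 / sig s0 s1.
    by rewrite sqrt_gam_ratio//; ring.
  have -> : g / Num.sqrt (1 + g) * t = Num.sqrt g * (t * s0 / sig s0 s1).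
    rewrite sqrt_gam1// sqrt_gam// /g gamE; field.
    by rewrite !gt_eqF.
  rewrite (coverage_split (Num.sqrt g) c (t * s0 / sig s0 s1) L c0 L0).
  rewrite {1}/window -/g -/c.
  set A := _ * (_ - _); set B := Rintegral _ _ _; set B' := Rintegral _ _ _.
  set B1 := Rintegral _ _ _; set B1' := Rintegral _ _ _.
  have BE : B1 = B.
    apply: eq_Rintegral => u _; rewrite /window.
    have -> : L - Num.sqrt g * (- c - u) = L + Num.sqrt g * (u + c) by ring.
    by have -> : - L - Num.sqrt g * (- c - u) = - L + Num.sqrt g * (u + c) by ring.
  have BE' : B1' = B'.
    apply: eq_Rintegral => u _; rewrite /window.
    have -> : L - Num.sqrt g * (c - u) = L + Num.sqrt g * (u - c) by ring.
    by have -> : - L - Num.sqrt g * (c - u) = - L + Num.sqrt g * (u - c) by ring.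
  by rewrite BE BE'.
move=> tau b zeta b0 /andP[zeta0 zeta1].
pose C L := coverage (Num.sqrt g) c (b * s0 / sig s0 s1) L.
(* By monotonicity in [|D|] the worst bias is [b * s0], so uniform coverage is coverage at that
   single bias. *)
have coverP L : 0 <= L ->
    (forall D, `|D / s0| <= b -> 1 - zeta <= covST s0 s1 alpha tau D L) <->
    1 - zeta <= C L.
  move=> L0; rewrite /C -(covE tau (b * s0) L L0); split => [|CL D Db].
    by apply; rewrite mulfK ?gt_eqF// ger0_norm.
  apply: (le_trans CL); apply: cov_le => //.
  rewrite normrM normfV (gtr0_norm s00) ler_pdivrMr// in Db.
  by rewrite [leRHS]ger0_norm// mulr_ge0// ltW.
have [L0 L00 CL0] : exists2 L, 0 <= L & C L = 1 - zeta.
  by apply: coverage_root; apply/andP; split; lra.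
(* Strict monotonicity turns the coverage requirement into a comparison with the root [L0]. *)
have CleP L : (1 - zeta <= C L) = (L0 <= L).
  rewrite -CL0; apply/idP/idP => [|/coverage_nondecreasing]; last exact.
  by apply: contraTT; rewrite -!ltNge => /coverage_increasing; exact.
set S := [set L : R | _]; move=> Lhat.
(* The admissible lengths form a closed ray, so their infimum is attained at [L0]. *)
have SE : S = [set L | L0 <= L].
  apply/seteqP; split => L /=.
    move=> [LL0 infL]; rewrite -CleP; apply: (le_trans infL); apply: ge_inf.
      (* Coverages are bounded below by 0, so their infimum is at most the value at [b * s0]. *)
      exists 0 => _ [D _ <-]; exact: fine_ge0.
    exists (b * s0); last by rewrite covE.
    by rewrite /= mulfK ?gt_eqF// ger0_norm.
  move=> L0L; have LL0 := le_trans L00 L0L; split => //.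
  apply: lb_le_inf.
    (* Zero bias is admissible since [b >= 0], so the set of coverages is nonempty. *)
    by exists (covST s0 s1 alpha tau 0 L), 0 => //=; rewrite mul0r normr0.
  by move=> _ [D Db <-]; apply: (coverP L LL0).2 => //; rewrite CleP.
have LhatE : Lhat = L0.
  rewrite /Lhat SE; apply/eqP; rewrite eq_le; apply/andP; split.
    by apply: ge_inf => //=; exists L0.
  by apply: lb_le_inf; [exists L0 => /=|].
rewrite LhatE; split => //.
- by rewrite covE.
- move=> L LL0; rewrite covE// => CL.
  have {}CL : C L = 1 - zeta by [].
  (* Any root satisfies [L0 <= L]; a strict inequality would give it a larger coverage. *)
  apply/eqP; rewrite eq_le -CleP CL lexx andbT leNgt; apply/negP.
  move=> /(coverage_increasing (Num.sqrt g) c (b * s0 / sig s0 s1)).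
  by rewrite -/(C L) -/(C L0) CL CL0 ltxx.
- by move=> L LL0; rewrite coverP// CleP.
Qed.
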